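(* $r(I_4, L_3) = 15$ and $r(I_5, L_3) = 23$.
   Context: An oriented graph is a finite directed graph with no loops in which each pair of distinct vertices is joined by at most one arc (in one direction). $I_m$ denotes the edgeless graph on $m$ vertices (an independent set of size $m$) and $L_n$ denotes the transitive tournament on $n$ vertices. An oriented graph $D$ is $(I_m, L_n)$-free if it contains neither an independent set of $m$ vertices nor $n$ vertices inducing a transitive tournament. $r(I_m, L_n)$ is the least natural number $k$ such that no oriented graph on $k$ vertices is $(I_m, L_n)$-free. *)

(* Defs.v *)
From mathcomp Require Import all_boot.
Set Implicit Arguments.
Unset Strict Implicit.
Unset Printing Implicit Defensive.

Record oriented_graph := OrientedGraph {
  vertex :> finType;
  arc : rel vertex;
  arc_irrefl : irreflexive arc;
  arc_asym : forall x y : vertex, x != y -> ~~ (arc x y && arc y x)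
}.

Definition independent (D : oriented_graph) (S : {set D}) : Prop :=
  {in S &, forall x y, ~~ arc x y}.

(* At most one of the two arcs is already guaranteed by arc_asym. *)
Definition tournament (D : oriented_graph) (S : {set D}) : Prop :=
  {in S &, forall x y, x != y -> arc x y || arc y x}.

Definition transitive_tournament (D : oriented_graph) (S : {set D}) : Prop :=
  tournament S /\ {in S & &, transitive (@arc D)}.

Definition IL_free (m n : nat) (D : oriented_graph) : Prop :=
  ~ (exists S : {set D}, #|S| = m /\ independent S) /\
  ~ (exists S : {set D}, #|S| = n /\ transitive_tournament S).

Definition no_IL_free_on (m n k : nat) : Prop :=
  forall D : oriented_graph, #|D| = k -> ~ IL_free m n D.

(* [is_r m n k] is the relation r(I_m, L_n) = k. It is functional in k, since a
   least element is unique; asserting it includes the existence of the minimum. *)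
Definition is_r (m n k : nat) : Prop :=
  no_IL_free_on m n k /\ forall j : nat, no_IL_free_on m n j -> k <= j.

(* Main.v *)
(** In an [L_3]-free oriented graph every out- and in-neighbourhood is
    independent, so a set without independent [m.+1]-subset has at most
    [2m + 1 + n] vertices, where [n] bounds the sets without independent
    [m]-subset: this gives 3, 8, 15 for [m = 1, 2, 3], and 23 for [m = 4] once
    15 is improved to 14.  The two improvements 15 -> 14 and 23 -> 22 have the
    same proof.  In a set attaining the bound all out- and in-degrees are [m],
    and the non-neighbourhood [H] of a vertex [x] is extremal of the previous
    level.  If [H] is [(m-1)]-regular in both directions, every vertex of [H]
    has exactly one neighbour in [N+(x)].  Counting arcs, only two go from
    [N+(x)] to [H]; all the other arcs leaving [N+(x)] end in [N-(x)], so some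
    two vertices of [N+(x)] have too many common out-neighbours.

    Regularity of [H] is a count for 8 vertices.  For 14 vertices it means that
    no vertex [y] has out-degree 3 and in-degree 2 (or conversely).  Otherwise
    the 8 non-neighbours of [y] are 2-regular among themselves, hence send at
    most one arc to the neighbours of [y] and receive at most one.  At most 3 of
    them have no neighbour in [N-(y)], at most 2 point to [N-(y)], and at most 3
    of those joined to [N-(y)] point to [N+(y)].  So all three numbers are
    attained, and this rigid configuration contains an 8-vertex
    non-neighbourhood in which a vertex has in-degree 3 instead of 2. *)

From mathcomp Require Import all_boot.
From mathcomp Require Import zify.
Require Import Defs.
Set Implicit Arguments.
Unset Strict Implicit.
Unset Printing Implicit Defensive.

Lemma setIdAC (T : finType) (S : {set T}) (P Q : pred T) :
  [set x in [set x in S | P x] | Q x] = [set x in [set x in S | Q x] | P x].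
Proof. by apply/setP => x; rewrite !inE andbAC. Qed.

Lemma double_count (T U : finType) (A : {set T}) (B : {set U})
    (r : T -> U -> bool) :
  \sum_(x in A) #|[set y in B | r x y]| = \sum_(y in B) #|[set x in A | r x y]|.
Proof.
under eq_bigr do rewrite -sum1dep_card big_mkcondr.
rewrite exchange_big /=; apply: eq_bigr => y _.
by rewrite -sum1dep_card [RHS]big_mkcondr.
Qed.

(** * Neighbourhoods and independent sets *)

Section Neighbourhoods.

Variable D : oriented_graph.
Implicit Types (x y z : D) (R S I J : {set D}).

Definition adj x y := arc x y || arc y x.
Definition nonadj x y := (x != y) && ~~ adj x y.
Definition out_nbrs S x := [set y in S | arc x y].
Definition in_nbrs S x := [set y in S | arc y x].
Definition nbrs S x := [set y in S | adj x y].
Definition non_nbrs S x := [set y in S | nonadj x y].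

Lemma mem_out_nbrs S x y : (y \in out_nbrs S x) = (y \in S) && arc x y.
Proof. by rewrite inE. Qed.

Lemma mem_in_nbrs S x y : (y \in in_nbrs S x) = (y \in S) && arc y x.
Proof. by rewrite inE. Qed.

Lemma mem_nbrs S x y : (y \in nbrs S x) = (y \in S) && adj x y.
Proof. by rewrite inE. Qed.

Lemma mem_non_nbrs S x y : (y \in non_nbrs S x) = (y \in S) && nonadj x y.
Proof. by rewrite inE. Qed.

Lemma arc_neq x y : arc x y -> x != y.
Proof. by apply: contraTneq => ->; rewrite arc_irrefl. Qed.

Lemma arc_antisym x y : arc x y -> arc y x = false.
Proof.
by move=> xy; have := arc_asym (arc_neq xy); rewrite xy => /negbTE.
Qed.

Lemma adjC x y : adj x y = adj y x.
Proof. by rewrite /adj orbC. Qed.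

Lemma adjxx x : adj x x = false.
Proof. by rewrite /adj arc_irrefl. Qed.

Lemma arc_adj x y : arc x y -> adj x y.
Proof. by rewrite /adj => ->. Qed.

Lemma nonadjC x y : nonadj x y = nonadj y x.
Proof. by rewrite /nonadj eq_sym adjC. Qed.

Lemma adjP x y : x != y -> ~~ nonadj x y -> adj x y.
Proof. by rewrite /nonadj => -> /=; rewrite negbK. Qed.

Lemma subset_out_nbrs S x : out_nbrs S x \subset S.
Proof. by apply/subsetP => y; rewrite inE => /andP[]. Qed.

Lemma subset_in_nbrs S x : in_nbrs S x \subset S.
Proof. by apply/subsetP => y; rewrite inE => /andP[]. Qed.

Lemma subset_non_nbrs S x : non_nbrs S x \subset S.
Proof. by apply/subsetP => y; rewrite inE => /andP[]. Qed.

Lemma card_nbrs R x : #|nbrs R x| = #|out_nbrs R x| + #|in_nbrs R x|.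
Proof.
rewrite -cardsUI (_ : out_nbrs R x :&: in_nbrs R x = set0) ?cards0 ?addn0.
  by apply: eq_card => y; rewrite !inE -andb_orr.
apply/setP => y; rewrite !inE andbACA andbb.
by case: (boolP (arc x y)) => [/arc_antisym->|]; rewrite ?andbF.
Qed.

Lemma card_nbrs_non_nbrs R x :
  #|R| = (x \in R) + #|nbrs R x| + #|non_nbrs R x|.
Proof.
rewrite (cardsD1 x) -addnA -(cardsID (nbrs R x)); congr (_ + (_ + _)).
  apply: eq_card => y; rewrite !inE; have [->|_] := eqVneq y x.
    by rewrite adjxx andbF.
  by case: (y \in R).
by apply: eq_card => y; rewrite !inE /nonadj eq_sym; case: (y \in R);
  rewrite ?andbF //= ?andbT andbC.
Qed.

Lemma card_setId_nbrs S x (P : pred D) :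
  #|[set z in S | P z]| = ((x \in S) && P x) +
     #|[set z in nbrs S x | P z]| + #|[set z in non_nbrs S x | P z]|.
Proof.
rewrite (card_nbrs_non_nbrs _ x) inE /nbrs /non_nbrs.
by rewrite !(setIdAC S P (adj x)) !(setIdAC S P (nonadj x)).
Qed.

Lemma card_setId_out_in S x (P : pred D) :
  #|[set z in nbrs S x | P z]| =
  #|[set z in out_nbrs S x | P z]| + #|[set z in in_nbrs S x | P z]|.
Proof.
rewrite [in LHS](setIdAC S (adj x)) [LHS]card_nbrs /out_nbrs /in_nbrs.
by rewrite !(setIdAC S P (arc x)) !(setIdAC S P (fun y => arc y x)).
Qed.

Lemma card_out_nbrs_split S x y :
  #|out_nbrs S y| = ((x \in S) && arc y x) +
    #|out_nbrs (nbrs S x) y| + #|out_nbrs (non_nbrs S x) y|.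
Proof. exact: card_setId_nbrs. Qed.

Lemma card_in_nbrs_split S x y :
  #|in_nbrs S y| = ((x \in S) && arc x y) +
    #|in_nbrs (nbrs S x) y| + #|in_nbrs (non_nbrs S x) y|.
Proof. exact: (card_setId_nbrs S x (fun z => arc z y)). Qed.

Lemma out_nbrs_nbrs S x : out_nbrs (nbrs S x) x = out_nbrs S x.
Proof.
apply/setP => y; rewrite !inE; case: (boolP (arc x y)) => [/arc_adj->|].
  by rewrite !andbT.
by rewrite !andbF.
Qed.

Lemma in_nbrs_nbrs S x : in_nbrs (nbrs S x) x = in_nbrs S x.
Proof.
apply/setP => y; rewrite !inE adjC; case: (boolP (arc y x)) => [/arc_adj->|].
  by rewrite !andbT.
by rewrite !andbF.
Qed.

Lemma card_nbrs_nbrs S x y :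
  #|nbrs (nbrs S x) y| = #|nbrs (out_nbrs S x) y| + #|nbrs (in_nbrs S x) y|.
Proof. exact: card_setId_out_in. Qed.

Definition I_free m S := forall I, I \subset S -> independent I -> #|I| < m.

Lemma I_freeS m R S : R \subset S -> I_free m S -> I_free m R.
Proof. by move=> RS S_free I IR; apply/S_free/(subset_trans IR). Qed.

Lemma independent1 x : independent [set x].
Proof. by move=> y z /set1P-> /set1P->; rewrite arc_irrefl. Qed.

Lemma independentU I J : independent I -> independent J ->
  {in I & J, forall x y, ~~ adj x y} -> independent (I :|: J).
Proof.
move=> I_ind J_ind IJ x y /setUP[xI|xJ] /setUP[yI|yJ].
- exact: I_ind.
- by have := IJ _ _ xI yJ; rewrite negb_or => /andP[].
- by have := IJ _ _ yI xJ; rewrite negb_or => /andP[].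
- exact: J_ind.
Qed.

Lemma independent_nonadj I : independent I ->
  {in I &, forall x y, x != y -> nonadj x y}.
Proof. by move=> I_ind x y xI yI xy; rewrite /nonadj xy negb_or !I_ind. Qed.

Lemma nbrs_independent0 I x : independent I -> x \in I -> nbrs I x = set0.
Proof.
move=> I_ind xI; apply/setP => y; rewrite !inE; apply/negbTE/negP.
by case/andP=> yI; apply/negP; rewrite negb_or !I_ind.
Qed.

Lemma I_free_apart k m S R I : I_free (k + m) S -> R \subset S -> I \subset S ->
  independent I -> #|I| = k -> {in R & I, forall x y, nonadj x y} -> I_free m R.
Proof.
move=> S_free RS IS I_ind cardI apart J JR J_ind.
have JI x y : x \in J -> y \in I -> nonadj x y.
  by move=> /(subsetP JR); apply: apart.
have /S_free : I :|: J \subset S by rewrite subUset IS (subset_trans JR).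
rewrite cardsU cardI (_ : I :&: J = set0) ?cards0 ?subn0 ?ltn_add2l.
  by apply; apply: independentU => // x y xI /JI/(_ xI)/andP[_]; rewrite adjC.
apply/setP => x; rewrite !inE; apply/negbTE/negP => /andP[xI xJ].
by have := JI x x xJ xI; rewrite /nonadj eqxx.
Qed.

Lemma I_free_non_nbrs m S x :
  x \in S -> I_free m.+1 S -> I_free m (non_nbrs S x).
Proof.
move=> xS S_free; apply: (@I_free_apart 1 m S _ [set x]) => //.
- exact: subset_non_nbrs.
- by rewrite sub1set.
- exact: independent1.
- exact: cards1.
- by move=> y _ + /set1P->; rewrite inE nonadjC => /andP[].
Qed.

Lemma I_free1_card S : I_free 1 S -> #|S| <= 0.
Proof.
move=> S_free; rewrite leqn0 cards_eq0; apply/set0Pn => -[x xS].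
have := S_free [set x]; rewrite sub1set xS cards1.
by move=> /(_ isT (@independent1 x)).
Qed.

Lemma card_nbrs_max_independent m S I x : I_free m.+1 S -> I \subset S ->
  independent I -> #|I| = m -> x \in S -> x \notin I -> 0 < #|nbrs I x|.
Proof.
move=> S_free IS I_ind cardI xS xI; rewrite card_gt0.
apply: contraT => /negPn/eqP I0.
have /I_free1_card : I_free 1 [set x].
  rewrite -addn1 in S_free.
  apply: (I_free_apart S_free _ IS I_ind cardI); first by rewrite sub1set.
  move=> _ y /set1P-> yI; rewrite /nonadj (contraNneq _ xI) => [|->] //=.
  by apply/negP => xy; have := in_set0 y; rewrite -I0 inE yI xy.
by rewrite cards1.
Qed.

Lemma I_free2_adj R x y : I_free 2 R -> x \in R -> y \in R -> x != y -> adj x y.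
Proof.
move=> R_free xR yR xy; apply: adjP xy _; apply/negP => /andP[neq nxy].
have xy_ind : independent [set x; y].
  apply: independentU => [||_ _ /set1P-> /set1P-> //]; exact: independent1.
have := R_free [set x; y]; rewrite cards2 neq subUset !sub1set xR yR.
by move=> /(_ isT xy_ind).
Qed.

Definition L3_free := forall x y z, arc x y -> arc y z -> ~~ arc x z.

End Neighbourhoods.

(** * Oriented graphs without transitive triangles *)

Section TriangleFree.

Variable D : oriented_graph.
Hypothesis D_L3_free : L3_free D.
Implicit Types (a b f g u v w x y z : D) (M R S I : {set D}).

Lemma adj_path x y z : arc x y -> arc y z -> adj x z -> arc z x.
Proof. by move=> xy yz /orP[] // xz; move: (D_L3_free xy yz); rewrite xz. Qed.

Lemma out_nonadj x y z : arc x y -> arc x z -> ~~ adj y z.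
Proof.
move=> xy xz; apply/negP => /orP[yz|zy].
  by move: (D_L3_free xy yz); rewrite xz.
by move: (D_L3_free xz zy); rewrite xy.
Qed.

Lemma in_nonadj x y z : arc y x -> arc z x -> ~~ adj y z.
Proof.
move=> yx zx; apply/negP => /orP[yz|zy].
  by move: (D_L3_free yz zx); rewrite yx.
by move: (D_L3_free zy yx); rewrite zx.
Qed.

Lemma out_nbrs_independent S x : independent (out_nbrs S x).
Proof.
move=> y z; rewrite !inE => /andP[_ xy] /andP[_ xz].
by have := out_nonadj xy xz; rewrite negb_or => /andP[].
Qed.

Lemma in_nbrs_independent S x : independent (in_nbrs S x).
Proof.
move=> y z; rewrite !inE => /andP[_ yx] /andP[_ zx].
by have := in_nonadj yx zx; rewrite negb_or => /andP[].
Qed.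

Lemma card_out_nbrs m S x : I_free m.+1 S -> #|out_nbrs S x| <= m.
Proof.
move=> S_free; rewrite -ltnS; apply: S_free (subset_out_nbrs S x) _.
exact: out_nbrs_independent.
Qed.

Lemma card_in_nbrs m S x : I_free m.+1 S -> #|in_nbrs S x| <= m.
Proof.
move=> S_free; rewrite -ltnS; apply: S_free (subset_in_nbrs S x) _.
exact: in_nbrs_independent.
Qed.

Lemma I_free_card m n S : (forall R, I_free m R -> #|R| <= n) ->
  I_free m.+1 S -> #|S| <= 1 + m + m + n.
Proof.
move=> bound S_free; have [->|[x xS]] := set_0Vmem S; first by rewrite cards0.
rewrite (card_nbrs_non_nbrs S x) xS card_nbrs.
have := card_out_nbrs x S_free; have := card_in_nbrs x S_free.
have := bound _ (I_free_non_nbrs xS S_free); lia.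
Qed.

Lemma extremal_regular m n S x : (forall R, I_free m R -> #|R| <= n) ->
  I_free m.+1 S -> #|S| = 1 + m + m + n -> x \in S ->
  [/\ #|out_nbrs S x| = m, #|in_nbrs S x| = m & #|non_nbrs S x| = n].
Proof.
move=> bound S_free cardS xS.
have := card_out_nbrs x S_free; have := card_in_nbrs x S_free.
have := bound _ (I_free_non_nbrs xS S_free).
by move: cardS; rewrite (card_nbrs_non_nbrs S x) xS card_nbrs; split; lia.
Qed.

Lemma I_free2_card S : I_free 2 S -> #|S| <= 3.
Proof. exact/I_free_card/I_free1_card. Qed.

Lemma I_free3_card S : I_free 3 S -> #|S| <= 8.
Proof. exact/I_free_card/I_free2_card. Qed.

Lemma I_free2_regular S x : I_free 2 S -> #|S| = 3 -> x \in S ->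
  #|out_nbrs S x| = 1 /\ #|in_nbrs S x| = 1.
Proof.
move=> S_free cardS xS.
by have [] := extremal_regular (@I_free1_card D) S_free cardS xS.
Qed.

Lemma I_free3_regular S x : I_free 3 S -> #|S| = 8 -> x \in S ->
  #|out_nbrs S x| = 2 /\ #|in_nbrs S x| = 2.
Proof.
move=> S_free cardS xS.
by have [] := extremal_regular I_free2_card S_free cardS xS.
Qed.

Lemma card_out_nbrs_out S x a : arc x a ->
  #|out_nbrs S a| =
  #|out_nbrs (in_nbrs S x) a| + #|out_nbrs (non_nbrs S x) a|.
Proof.
move=> xa; rewrite (card_out_nbrs_split S x) {1}/out_nbrs card_setId_out_in.
rewrite (arc_antisym xa) andbF (_ : [set z in out_nbrs S x | arc a z] = set0).
  by rewrite cards0.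
apply/setP => z; rewrite !inE; apply/negbTE/negP => /andP[/andP[_ xz] az].
by move: (D_L3_free xa az); rewrite xz.
Qed.

Lemma card_in_nbrs_out S x a : x \in S -> arc x a ->
  #|in_nbrs S a| = (#|in_nbrs (non_nbrs S x) a|).+1.
Proof.
move=> xS xa; rewrite (card_in_nbrs_split S x) xS xa.
suff -> : in_nbrs (nbrs S x) a = set0 by rewrite cards0.
apply/setP => z; rewrite !inE; apply/negbTE/negP => /andP[/andP[_ xz] za].
by move: (in_nonadj xa za); rewrite xz.
Qed.

Section RegularGluing.

Variables (k : nat) (S : {set D}).
Hypothesis S_free : I_free k.+2 S.
Hypothesis S_regular : forall x, x \in S ->
  #|out_nbrs S x| = k.+1 /\ #|in_nbrs S x| = k.+1.
Hypothesis non_nbrs_regular : forall x y, x \in S -> y \in non_nbrs S x ->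
  #|out_nbrs (non_nbrs S x) y| = k /\ #|in_nbrs (non_nbrs S x) y| = k.

(* [y] has one out- and one in-neighbour outside [non_nbrs S x], while the
   maximum independent sets [out_nbrs S x] and [in_nbrs S x] each contain a
   neighbour of [y]. *)
Lemma card_common_out_nbrs x y : x \in S -> y \in non_nbrs S x ->
  #|nbrs (out_nbrs S x) y| = 1.
Proof.
move=> xS yH; have := yH; rewrite inE => /andP[yS]; rewrite /nonadj negb_or.
case/and3P=> _ /negbTE xy /negbTE yx.
have [[out_x in_x] [out_y in_y]] := (S_regular xS, S_regular yS).
have [out_Hy in_Hy] := non_nbrs_regular xS yH.
have := card_nbrs_max_independent S_free (subset_out_nbrs S x)
  (@out_nbrs_independent S x) out_x yS.
have := card_nbrs_max_independent S_free (subset_in_nbrs S x)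
  (@in_nbrs_independent S x) in_x yS.
rewrite ![y \in _]inE xy yx !andbF => /(_ isT) + /(_ isT).
have := card_out_nbrs_split S x y; rewrite out_y out_Hy yx andbF.
have := card_in_nbrs_split S x y; rewrite in_y in_Hy xy andbF.
have := card_nbrs (nbrs S x) y.
have := card_nbrs_nbrs S x y; lia.
Qed.

Lemma sum_out_nbrs_non_nbrs x : x \in S ->
  \sum_(a in out_nbrs S x) #|out_nbrs (non_nbrs S x) a| + k * k.+1 =
  #|non_nbrs S x|.
Proof.
move=> xS; have [out_x _] := S_regular xS.
have -> : k * k.+1 = \sum_(a in out_nbrs S x) #|in_nbrs (non_nbrs S x) a|.
  rewrite -out_x mulnC -sum_nat_const; apply: eq_bigr => a.
  rewrite inE => /andP[aS xa]; have [_ in_a] := S_regular aS.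
  by have := card_in_nbrs_out xS xa; rewrite in_a => -[].
rewrite -big_split /=; under eq_bigr do rewrite -card_nbrs /nbrs.
rewrite double_count -sum1_card; apply: eq_bigr => y yH.
rewrite -(card_common_out_nbrs xS yH); apply: eq_card => z.
by rewrite !inE adjC.
Qed.

(* The nonadjacent vertices [a, b] have at most one common out-neighbour, while
   their out-neighbours outside [non_nbrs S x] all lie in [in_nbrs S x]. *)
Lemma card_out_nbrs_pair x a b : x \in S ->
    a \in out_nbrs S x -> b \in out_nbrs S x -> a != b ->
  k <= #|out_nbrs (non_nbrs S x) a| + #|out_nbrs (non_nbrs S x) b|.
Proof.
move=> xS aA bA ab.
have nab := independent_nonadj (@out_nbrs_independent S x) aA bA ab.
move: aA bA; rewrite !mem_out_nbrs => /andP[aS xa] /andP[bS xb].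
have bH : b \in non_nbrs S a by rewrite mem_non_nbrs bS.
have sub : out_nbrs (in_nbrs S x) a :&: out_nbrs (in_nbrs S x) b
           \subset nbrs (out_nbrs S a) b.
  apply/subsetP => z; rewrite !inE => /andP[/andP[/andP[-> _] ->] /andP[_ bz]].
  exact: arc_adj.
have := subset_leq_card sub; rewrite (card_common_out_nbrs aS bH).
have : out_nbrs (in_nbrs S x) a :|: out_nbrs (in_nbrs S x) b
       \subset in_nbrs S x by rewrite subUset !subset_out_nbrs.
move/subset_leq_card; rewrite cardsU.
have := subset_leq_card (subsetIl (out_nbrs (in_nbrs S x) a)
                                  (out_nbrs (in_nbrs S x) b)).
have [[_ ->] [out_a _]] := (S_regular xS, S_regular aS).
have [out_b _] := S_regular bS.
have := card_out_nbrs_out S xa; have := card_out_nbrs_out S xb.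
by rewrite out_a out_b; lia.
Qed.

Lemma card_non_nbrs_gt x : 1 < k -> x \in S -> k * k.+1 + 2 < #|non_nbrs S x|.
Proof.
move=> k_gt1 xS; rewrite -(sum_out_nbrs_non_nbrs xS) addnC ltn_add2r.
have [out_x _] := S_regular xS.
have /card_gt2P[a [b [c [[aA bA cA] [ab bc ca]]]]] : 2 < #|out_nbrs S x|.
  by rewrite out_x.
have cA' : c \in out_nbrs S x :\ a :\ b by rewrite !in_setD1 eq_sym bc ca.
have bA' : b \in out_nbrs S x :\ a by rewrite in_setD1 eq_sym ab.
rewrite (big_setD1 a) //= (big_setD1 b) //= (big_setD1 c) //=.
have := card_out_nbrs_pair xS aA bA ab; have := card_out_nbrs_pair xS bA cA bc.
have := card_out_nbrs_pair xS cA aA ca; lia.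
Qed.

End RegularGluing.

Lemma I_free_card_improved k S : 1 < k ->
    (forall R, I_free k.+1 R -> #|R| <= k * k.+1 + 2) ->
    (forall R x, I_free k.+1 R -> #|R| = k * k.+1 + 2 -> x \in R ->
      #|out_nbrs R x| = k /\ #|in_nbrs R x| = k) ->
  I_free k.+2 S -> #|S| <= k.+1 * k.+2 + 2.
Proof.
move=> k_gt1 bound extremal S_free.
have := I_free_card bound S_free.
rewrite leq_eqVlt => /predU1P[cardS|]; last by lia.
have regular x (xS : x \in S) := extremal_regular bound S_free cardS xS.
have [x xS] : exists x, x \in S by apply/card_gt0P; rewrite cardS.
have [_ _ cardH] := regular x xS.
suff : k * k.+1 + 2 < #|non_nbrs S x| by rewrite cardH ltnn.
apply: card_non_nbrs_gt => // [y /regular[]//|y z yS].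
by apply: extremal (I_free_non_nbrs yS S_free) _; have [] := regular y yS.
Qed.

(** * Vertices of degree five in extremal graphs on 14 vertices *)

(* Otherwise [a] and [x] are not adjacent, so [f, g, x] is a triangle, and [x]
   has the three in-neighbours [v], [g] and one in [M]. *)
Lemma triangle_no_in_arc R M a f g v x :
    I_free 3 R -> #|R| = 8 -> M \subset R -> I_free 2 M -> #|M| = 3 ->
    a \in R :\: M -> v \in R :\: M -> arc v a ->
    f \in R :\: M -> g \in R :\: M -> f != g -> ~~ arc g f ->
    nonadj a f -> nonadj a g ->
  x \in M -> ~~ arc v x.
Proof.
move=> R_free cardR MR M_free cardM /setDP[aR aM] /setDP[vR vM] va.
case/setDP=> fR fM /setDP[gR gM] neq_fg gf af ag xM; apply/negP => vx.
have neqM u : u \notin M -> u != x by apply: contraNneq => ->.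
have xaN : x \in non_nbrs R a.
  rewrite inE (subsetP MR) //= /nonadj neqM //.
  exact: (out_nonadj va vx).
have faN : f \in non_nbrs R a by rewrite mem_non_nbrs fR.
have gaN : g \in non_nbrs R a by rewrite mem_non_nbrs gR.
have N_adj := I_free2_adj (I_free_non_nbrs aR R_free).
have fg : arc f g.
  by have := N_adj _ _ faN gaN neq_fg; rewrite /adj (negbTE gf) orbF.
have gx : arc g x.
  have /orP[//|xg] := N_adj _ _ gaN xaN (neqM _ gM).
  by have := in_nonadj fg xg; rewrite N_adj ?neqM.
have gv : g != v.
  by apply: contraTneq ag => ->; rewrite /nonadj adjC (arc_adj va) andbF.
have [_ in_x] := I_free3_regular R_free cardR (subsetP MR x xM).
have [_ in_M] := I_free2_regular M_free cardM xM.
have : in_nbrs M x :|: [set g; v] \subset in_nbrs R x.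
  rewrite !subUset !sub1set !inE vx gx vR gR //=.
  rewrite andbT; apply/subsetP => u; rewrite !inE.
  by case/andP=> /(subsetP MR)-> ->.
move/subset_leq_card; rewrite cardsU cards2 gv in_x in_M.
suff -> : in_nbrs M x :&: [set g; v] = set0 by rewrite cards0.
apply/setP => u; rewrite !inE; apply/negbTE/negP => /andP[/andP[uM _]].
by case/pred2P=> uE; move: uM; apply/negP; rewrite uE.
Qed.

Section DegreeFive.

Variables (S : {set D}) (y : D).
Hypothesis S_free : I_free 4 S.
Hypothesis yS : y \in S.
Hypothesis card_out_y : #|out_nbrs S y| = 3.
Hypothesis card_in_y : #|in_nbrs S y| = 2.
Hypothesis card_non_y : #|non_nbrs S y| = 8.

Local Notation Nout := (out_nbrs S y).
Local Notation Nin := (in_nbrs S y).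
Local Notation Nnon := (non_nbrs S y).

Definition linked := [set w in Nnon | nbrs Nin w != set0].
Definition unlinked := Nnon :\: linked.

Lemma linkedP w :
  reflect (w \in Nnon /\ exists2 b, b \in Nin & adj w b) (w \in linked).
Proof.
apply: (iffP setIdP) => -[wH].
  by case/set0Pn=> b; rewrite inE => /andP[bI wb]; split=> //; exists b.
by case=> b bI wb; split=> //; apply/set0Pn; exists b; rewrite inE bI.
Qed.

Lemma linked_Nnon : linked \subset Nnon.
Proof. by apply/subsetP => w /linkedP[]. Qed.

Lemma card_common_nbrs_le1 w : w \in Nnon ->
  #|out_nbrs (nbrs S y) w| <= 1 /\ #|in_nbrs (nbrs S y) w| <= 1.
Proof.
move=> wH; have W_free := I_free_non_nbrs yS S_free.
have [out_w in_w] := I_free3_regular W_free card_non_y wH.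
have := card_out_nbrs_split S y w; have := card_in_nbrs_split S y w.
have := card_out_nbrs w S_free.
have := card_in_nbrs w S_free; lia.
Qed.

Lemma common_out_unique w : w \in Nnon ->
  {in nbrs S y &, forall u v, arc w u -> arc w v -> u = v}.
Proof.
move=> /card_common_nbrs_le1[/card_le1_eqP out1 _] u v uN vN wu wv.
by apply: out1; rewrite inE ?uN ?vN.
Qed.

Lemma common_in_unique w : w \in Nnon ->
  {in nbrs S y &, forall u v, arc u w -> arc v w -> u = v}.
Proof.
move=> /card_common_nbrs_le1[_ /card_le1_eqP in1] u v uN vN uw vw.
by apply: in1; rewrite inE ?uN ?vN.
Qed.

Lemma mem_Nout_nbrs a : a \in Nout -> a \in nbrs S y.
Proof. by rewrite !inE => /andP[-> /arc_adj]. Qed.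

Lemma mem_Nin_nbrs b : b \in Nin -> b \in nbrs S y.
Proof. by rewrite !inE adjC => /andP[-> /arc_adj]. Qed.

Lemma neq_Nout_Nin a b : a \in Nout -> b \in Nin -> a != b.
Proof.
rewrite !inE => /andP[_ ya] /andP[_]; apply: contraTneq => <-.
by rewrite (arc_antisym ya).
Qed.

Lemma neq_Nnon_nbrs w u : w \in Nnon -> u \in nbrs S y -> w != u.
Proof.
by rewrite !inE => /and3P[_ _ yw] /andP[_]; apply: contraTneq => <-.
Qed.

Lemma card_nbrs_Nout_gt0 w : w \in Nnon -> 0 < #|nbrs Nout w|.
Proof.
rewrite inE => /andP[wS /andP[_]]; rewrite negb_or => /andP[yw _].
apply: (card_nbrs_max_independent S_free) => //; first exact: subset_out_nbrs.
  exact: out_nbrs_independent.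
by rewrite inE (negbTE yw) andbF.
Qed.

Lemma card_nbrs_Nout_Nin w : w \in Nnon -> #|nbrs Nout w| + #|nbrs Nin w| <= 2.
Proof.
move=> wH; rewrite -card_nbrs_nbrs card_nbrs.
by have := card_common_nbrs_le1 wH; lia.
Qed.

Lemma Nin_nbr_unique w : w \in Nnon ->
  {in Nin &, forall b b', adj w b -> adj w b' -> b = b'}.
Proof.
move=> wH b b' bI b'I wb wb'.
have /card_le1_eqP nbr1 : #|nbrs Nin w| <= 1.
  by have := card_nbrs_Nout_Nin wH; have := card_nbrs_Nout_gt0 wH; lia.
by apply: nbr1; rewrite inE ?bI ?b'I.
Qed.

Lemma Nout_nbr_unique w : w \in linked ->
  {in Nout &, forall a a', adj w a -> adj w a' -> a = a'}.
Proof.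
rewrite inE -card_gt0 => /andP[wH in_gt0] a a' aO a'O wa wa'.
have /card_le1_eqP nbr1 : #|nbrs Nout w| <= 1.
  by have := card_nbrs_Nout_Nin wH; lia.
by apply: nbr1; rewrite inE ?aO ?a'O.
Qed.

Lemma arc_from_Nout w b : w \in Nnon -> b \in Nin -> arc w b ->
  exists2 a, a \in Nout & arc a w.
Proof.
move=> wH bI wb; have /card_gt0P[a] := card_nbrs_Nout_gt0 wH.
rewrite inE => /andP[aO /orP[wa|aw]]; last by exists a.
have := neq_Nout_Nin aO bI.
by rewrite (common_out_unique wH (mem_Nout_nbrs aO) (mem_Nin_nbrs bI)) ?eqxx.
Qed.

Lemma arc_to_Nout w b : w \in Nnon -> b \in Nin -> arc b w ->
  exists2 a, a \in Nout & arc w a.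
Proof.
move=> wH bI bw; have /card_gt0P[a] := card_nbrs_Nout_gt0 wH.
rewrite inE => /andP[aO /orP[wa|aw]]; first by exists a.
have := neq_Nout_Nin aO bI.
by rewrite (common_in_unique wH (mem_Nout_nbrs aO) (mem_Nin_nbrs bI)) ?eqxx.
Qed.

Lemma arc_from_Nin v a : v \in linked -> a \in Nout -> arc v a ->
  exists2 b, b \in Nin & arc b v.
Proof.
move=> vL aO va; have [vH [b bI /orP[vb|bv]]] := linkedP _ vL; last by exists b.
have := neq_Nout_Nin aO bI.
by rewrite (common_out_unique vH (mem_Nout_nbrs aO) (mem_Nin_nbrs bI)) ?eqxx.
Qed.

Lemma I_free2_unlinked : I_free 2 unlinked.
Proof.
apply: (I_free_apart (S_free : I_free (2 + 2) S) _ (subset_in_nbrs S y)) => //.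
- by rewrite subDset subsetU // subset_non_nbrs orbT.
- exact: in_nbrs_independent.
move=> w b /setDP[wH wL] bI; rewrite /nonadj neq_Nnon_nbrs ?mem_Nin_nbrs //=.
by apply: contra wL => wb; apply/linkedP; split=> //; exists b.
Qed.

Lemma I_free2_nbrs_linked a : a \in Nout -> I_free 2 (nbrs linked a).
Proof.
move=> aO; have card2 : #|Nout :\ a| = 2.
  by have := cardsD1 a Nout; rewrite aO card_out_y => -[].
apply: (I_free_apart (S_free : I_free (2 + 2) S) _ _ _ card2).
- by apply/subsetP => w; rewrite !inE => /andP[/andP[/andP[]]].
- by rewrite subDset subsetU // subset_out_nbrs orbT.
- move=> u v /setD1P[_ uN] /setD1P[_ vN].
  exact: (out_nbrs_independent uN vN).
move=> w a'; rewrite inE => /andP[wL aw] /setD1P[a'a a'O].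
have [wH _] := linkedP _ wL; rewrite /nonadj neq_Nnon_nbrs ?mem_Nout_nbrs //=.
apply: contra a'a => wa'; apply/eqP; apply: (Nout_nbr_unique wL) => //.
by rewrite adjC.
Qed.

Lemma out_linked_unique a : a \in Nout ->
  {in linked &, forall u v, arc a u -> arc a v -> u = v}.
Proof.
move=> /I_free2_nbrs_linked/(card_out_nbrs a).
rewrite out_nbrs_nbrs => /card_le1_eqP out1 u v uL vL au av.
by apply: out1; rewrite mem_out_nbrs ?uL ?vL.
Qed.

Lemma card_in_linked_Nout_le1 a : a \in Nout -> #|in_nbrs linked a| <= 1.
Proof.
by move=> /I_free2_nbrs_linked/(card_in_nbrs a); rewrite in_nbrs_nbrs.
Qed.

Lemma nonadj_Nout_Nin a b w : a \in Nout -> b \in Nin ->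
  arc a w -> arc w b -> nonadj a b.
Proof.
move=> aO bI aw wb.
rewrite /nonadj neq_Nout_Nin //= negb_or (D_L3_free aw wb) /=.
by move: aO bI; rewrite !inE => /andP[_ ya] /andP[_ /D_L3_free]; apply.
Qed.

(* If [a -> u -> b] then the in-neighbours of [b'] in [linked] avoid both [a]
   and [b], which are not adjacent. *)
Lemma card_in_linked_Nin_le1 b b' u : b \in Nin -> b' \in Nin -> b != b' ->
  u \in in_nbrs linked b -> #|in_nbrs linked b'| <= 1.
Proof.
move=> bI b'I bb'; rewrite inE => /andP[uL ub].
have [uH _] := linkedP _ uL; have [a aO au] := arc_from_Nout uH bI ub.
have [aS bS] : a \in S /\ b \in S.
  by rewrite (subsetP (subset_out_nbrs S y)) ?(subsetP (subset_in_nbrs S y)).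
have /andP[ab nab] := nonadj_Nout_Nin aO bI au ub.
have card2 : #|[set a; b]| = 2 by rewrite cards2 ab.
suff : I_free 2 (in_nbrs linked b').
  by apply; [apply: subxx | apply: in_nbrs_independent].
apply: (I_free_apart (S_free : I_free (2 + 2) S) _ _ _ card2).
- by apply/subsetP => w; rewrite !inE => /andP[/andP[/andP[]]].
- by rewrite subUset !sub1set aS bS.
- by apply: independentU => [||_ _ /set1P-> /set1P->] //; apply: independent1.
move=> w c; rewrite mem_in_nbrs => /andP[wL wb'] c_ab.
have [wH _] := linkedP _ wL; apply/andP; split.
  apply: neq_Nnon_nbrs wH _.
  by case/set2P: c_ab => ->; [apply: mem_Nout_nbrs | apply: mem_Nin_nbrs].
apply/negP; case/set2P: c_ab => ->; first case/orP=> [wa|aw].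
- have := neq_Nout_Nin aO b'I; apply/negP; rewrite negbK; apply/eqP.
  exact: (common_out_unique wH (mem_Nout_nbrs aO) (mem_Nin_nbrs b'I) wa wb').
- have ub' : arc u b' by rewrite -(out_linked_unique aO wL uL aw au).
  by move: bb'; rewrite (Nin_nbr_unique uH bI b'I) ?arc_adj ?eqxx.
- by move=> wb; move: bb'; rewrite (Nin_nbr_unique wH bI b'I wb) ?eqxx ?arc_adj.
Qed.

Lemma card_linked_le :
  #|linked| <= \sum_(b in Nin) #|in_nbrs linked b| +
              \sum_(a in Nout) #|in_nbrs linked a|.
Proof.
rewrite [X in X + _]double_count [X in _ + X]double_count -big_split /=.
rewrite -sum1_card.
apply: leq_sum => w /linkedP[wH [b bI /orP[wb|bw]]].
  by apply/ltn_addr/card_gt0P; exists b; rewrite inE bI.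
have [a aO wa] := arc_to_Nout wH bI bw.
by apply/ltn_addl/card_gt0P; exists a; rewrite inE aO.
Qed.

Lemma card_linked_unlinked : #|linked| + #|unlinked| = 8.
Proof.
rewrite -card_non_y -(cardsID linked Nnon); congr (_ + _).
by apply: eq_card => w; rewrite !inE; case: (w \in S); case: nonadj.
Qed.

Lemma Nin_eq b b' : b \in Nin -> b' \in Nin -> b != b' -> Nin = [set b; b'].
Proof.
move=> bI b'I bb'.
by apply/esym/eqP; rewrite eqEcard subUset !sub1set bI b'I card_in_y cards2 bb'.
Qed.

Lemma card_in_linked_Nin_le2 b b' : b \in Nin -> b' \in Nin -> b != b' ->
  #|in_nbrs linked b| + #|in_nbrs linked b'| <= 2.
Proof.
move=> bI b'I bb'.
have max2 c : #|in_nbrs linked c| <= 2.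
  exact: card_in_nbrs (I_freeS linked_Nnon (I_free_non_nbrs yS S_free)).
have [->|[u ub]] := set_0Vmem (in_nbrs linked b); first by rewrite cards0 max2.
have [->|[v vb']] := set_0Vmem (in_nbrs linked b').
  by rewrite cards0 addn0 max2.
rewrite -[2]/(1 + 1) leq_add //; last exact: card_in_linked_Nin_le1 ub.
by apply: card_in_linked_Nin_le1 vb'; rewrite // eq_sym.
Qed.

(* Since 8 <= 3 + 2 + 3, equality holds in all three bounds. *)
Lemma linked_counts b b' : b \in Nin -> b' \in Nin -> b != b' ->
  [/\ #|unlinked| = 3, #|in_nbrs linked b| + #|in_nbrs linked b'| = 2 &
      {in Nout, forall a, #|in_nbrs linked a| = 1}].
Proof.
move=> bI b'I bb'; have sumB (F : D -> nat) : \sum_(c in Nin) F c = F b + F b'.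
  by rewrite (Nin_eq bI b'I bb') big_setU1 ?inE //= big_set1.
have := card_linked_le; rewrite sumB.
have := card_in_linked_Nin_le2 bI b'I bb'.
have := I_free2_card I_free2_unlinked.
have := card_linked_unlinked.
have sum_le (R : {set D}) : R \subset Nout ->
    \sum_(a in R) #|in_nbrs linked a| <= #|R|.
  rewrite -sum1_card => RA; apply: leq_sum => a /(subsetP RA).
  exact: card_in_linked_Nout_le1.
have := sum_le Nout (subxx Nout); rewrite card_out_y.
move=> ? ? ? ? ?; split; [lia | lia | move=> a aO].
have := card_in_linked_Nout_le1 aO.
have := sum_le (Nout :\ a) (subsetDl Nout _).
have := cardsD1 a Nout; rewrite aO card_out_y.
have : \sum_(c in Nout) #|in_nbrs linked c| =
    #|in_nbrs linked a| + \sum_(c in Nout :\ a) #|in_nbrs linked c|.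
  exact: big_setD1.
lia.
Qed.

Lemma nonadj_Nout_linked a a' w : a \in Nout -> a' \in Nout -> a != a' ->
  w \in linked -> adj w a' -> nonadj a w.
Proof.
move=> aO a'O aa' wL wa'; have [wH _] := linkedP _ wL.
rewrite nonadjC /nonadj neq_Nnon_nbrs ?mem_Nout_nbrs //=.
by apply: contra aa' => wa; rewrite (Nout_nbr_unique wL aO a'O wa wa').
Qed.

Lemma nonadj_Nin_Nnon b b' w : b \in Nin -> b' \in Nin -> b != b' ->
  w \in Nnon -> adj w b' -> nonadj b w.
Proof.
move=> bI b'I bb' wH wb'.
rewrite nonadjC /nonadj neq_Nnon_nbrs ?mem_Nin_nbrs //=.
by apply: contra bb' => wb; rewrite (Nin_nbr_unique wH bI b'I wb wb').
Qed.

Lemma nbrs_linked_subset b b' : b \in Nin -> b' \in Nin -> b != b' ->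
  nbrs linked b \subset non_nbrs linked b'.
Proof.
move=> bI b'I bb'; apply/subsetP => w; rewrite mem_nbrs => /andP[wL bw].
have [wH _] := linkedP _ wL; rewrite mem_non_nbrs wL.
by apply: (nonadj_Nin_Nnon b'I bI) wH _; rewrite 1?eq_sym // adjC.
Qed.

Lemma returning_path b b' a u : b \in Nin -> b' \in Nin -> b != b' ->
    a \in Nout -> u \in linked -> arc a u -> arc u b ->
  exists v, [/\ v \in linked, arc u v, arc v a & arc b' v].
Proof.
move=> bI b'I bb' aO uL au ub; have [_ _ in_A] := linked_counts bI b'I bb'.
have /card_gt0P[v] : 0 < #|in_nbrs linked a| by rewrite in_A.
rewrite mem_in_nbrs => /andP[vL va].
have neq_vu : v != u by apply: contraTneq va => ->; rewrite (arc_antisym au).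
have uv : arc u v.
  apply: (adj_path va au).
  apply: (I_free2_adj (I_free2_nbrs_linked aO)) => //.
    by rewrite in_set vL adjC arc_adj.
  by rewrite in_set uL arc_adj.
have [c cI cv] := arc_from_Nin vL aO va.
exists v; split=> //; move: cI; rewrite (Nin_eq bI b'I bb') => /set2P[] cE.
  by rewrite cE in cv; have := D_L3_free ub cv; rewrite uv.
by rewrite -cE.
Qed.

Lemma unlinked_non_nbrs b : b \in Nin -> unlinked \subset non_nbrs S b.
Proof.
move=> bI; apply/subsetP => w /setDP[wH wL].
rewrite mem_non_nbrs (subsetP (subset_non_nbrs S y)) //=.
rewrite nonadjC /nonadj neq_Nnon_nbrs ?mem_Nin_nbrs //=.
by apply: contra wL => wb; apply/linkedP; split=> //; exists b.
Qed.

Lemma card_non_nbrs_Nin b b' : b \in Nin -> b' \in Nin -> b != b' ->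
  #|non_nbrs S b| = 4 + #|non_nbrs Nout b| + #|non_nbrs linked b|.
Proof.
move=> bI b'I bb'; have [cardM _ _] := linked_counts bI b'I bb'.
have nby : nonadj b y = false.
  by move: bI; rewrite inE /nonadj => /andP[_ /arc_adj->]; rewrite andbF.
have non_Bb : #|non_nbrs Nin b| = 1.
  have := card_nbrs_non_nbrs Nin b; rewrite bI card_in_y.
  rewrite nbrs_independent0 ?cards0 // => [[]//|].
  exact: in_nbrs_independent.
have -> : #|non_nbrs S b| =
    #|non_nbrs Nout b| + #|non_nbrs Nin b| + #|non_nbrs Nnon b|.
  by rewrite [LHS](card_setId_nbrs S y) nby andbF card_setId_out_in.
rewrite non_Bb -(cardsID linked (non_nbrs Nnon b)).
have -> : non_nbrs Nnon b :&: linked = non_nbrs linked b.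
  apply/setP => w; rewrite in_setI mem_non_nbrs (mem_non_nbrs linked) andbAC.
  congr (_ && _).
  by apply/andP/idP => [[]//|wL]; split=> //; have [] := linkedP _ wL.
suff -> : non_nbrs Nnon b :\: linked = unlinked by rewrite cardM; lia.
apply/setP => w; rewrite !in_setD mem_non_nbrs; apply: andb_id2l => wL.
case: (boolP (w \in Nnon)) => //= wH.
have : w \in unlinked by rewrite in_setD wL.
by move/(subsetP (unlinked_non_nbrs bI)); rewrite mem_non_nbrs => /andP[].
Qed.

Lemma card_non_nbrs_Nin_eq8 b b' : b \in Nin -> b' \in Nin -> b != b' ->
  4 <= #|non_nbrs Nout b| + #|non_nbrs linked b| -> #|non_nbrs S b| = 8.
Proof.
move=> bI b'I bb' ge4; apply/eqP; rewrite eqn_leq I_free3_card //=; last first.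
  exact: I_free_non_nbrs (subsetP (subset_in_nbrs S y) _ bI) S_free.
by rewrite (card_non_nbrs_Nin bI b'I bb') -addnA -[8]/(4 + 4) leq_add2l.
Qed.

Lemma card_out_nbrs_Nnon b a v : b \in Nin -> #|non_nbrs S b| = 8 ->
    a \in non_nbrs Nout b -> v \in non_nbrs linked b -> arc v a ->
  #|out_nbrs (non_nbrs Nnon b) v| = 1 /\ #|out_nbrs (nbrs Nnon b) v| = 1.
Proof.
move=> bI cardR; rewrite ![_ \in non_nbrs _ b]mem_non_nbrs.
case/andP=> aO ba /andP[vL bv] va; have [vH _] := linkedP _ vL.
have bS := subsetP (subset_in_nbrs S y) _ bI.
have vR : v \in non_nbrs S b.
  by rewrite mem_non_nbrs bv (subsetP (subset_non_nbrs S y)).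
have [out_v _] := I_free3_regular (I_free_non_nbrs bS S_free) cardR vR.
have [out_Hv _] :=
  I_free3_regular (I_free_non_nbrs yS S_free) card_non_y vH.
have bH : b \in Nnon = false.
  by apply/negP => /neq_Nnon_nbrs/(_ (mem_Nin_nbrs bI)); rewrite eqxx.
have vy : arc v y = false.
  move: vH; rewrite mem_non_nbrs => /and3P[_ _].
  by rewrite negb_or => /andP[_ /negbTE].
have out_N : #|out_nbrs (nbrs (non_nbrs S b) y) v| = 1.
  apply/eqP; rewrite eqn_leq; apply/andP; split.
    have [out1 _] := card_common_nbrs_le1 vH; apply: leq_trans out1.
    apply/subset_leq_card/subsetP => u; rewrite !inE.
    by case/andP=> /andP[/andP[-> _] ->].
  apply/card_gt0P; exists a; move: aO; rewrite !inE => /andP[aS ya].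
  by rewrite aS ba va arc_adj.
have out_HN : #|out_nbrs (non_nbrs Nnon b) v| = 1.
  have -> : non_nbrs Nnon b = non_nbrs (non_nbrs S b) y by exact: setIdAC.
  have := card_out_nbrs_split (non_nbrs S b) y v.
  by rewrite vy andbF out_v out_N => -[].
have := card_out_nbrs_split Nnon b v.
by rewrite bH out_Hv out_HN addn1 => -[].
Qed.

Lemma unlinked_of_path b b' v x : b \in Nin -> b' \in Nin -> b != b' ->
  x \in non_nbrs Nnon b -> arc b' v -> arc v x -> x \notin in_nbrs linked b' ->
  x \in unlinked.
Proof.
move=> bI b'I bb'; rewrite mem_non_nbrs mem_in_nbrs => /andP[xH /andP[_ nbx]].
move=> b'v vx xb'; apply/setDP; split=> //; apply: contra xb' => xL.
rewrite xL /=; have [_ [c]] := linkedP _ xL.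
rewrite (Nin_eq bI b'I bb') => /set2P[] ->; first by rewrite adjC (negbTE nbx).
by rewrite /adj (negbTE (D_L3_free b'v vx)) orbF.
Qed.

Lemma non_nbrs_Nout_subset b :
  non_nbrs Nout b \subset non_nbrs S b :\: unlinked.
Proof.
apply/subsetP => a; rewrite mem_non_nbrs => /andP[aO ba]; apply/setDP; split.
  by rewrite mem_non_nbrs ba (subsetP (subset_out_nbrs S y)).
apply/setDP => -[aH _].
by have := neq_Nnon_nbrs aH (mem_Nout_nbrs aO); rewrite eqxx.
Qed.

Lemma non_nbrs_linked_subset b :
  non_nbrs linked b \subset non_nbrs S b :\: unlinked.
Proof.
apply/subsetP => w; rewrite mem_non_nbrs => /andP[wL bw]; apply/setDP; split.
  have [wH _] := linkedP _ wL.
  by rewrite mem_non_nbrs bw (subsetP (subset_non_nbrs S y)).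
by apply/setDP => -[_]; rewrite wL.
Qed.

Lemma arc_to_in_nbrs b b' a f g v : b \in Nin -> b' \in Nin -> b != b' ->
    #|non_nbrs S b| = 8 -> a \in non_nbrs Nout b -> v \in non_nbrs linked b ->
    arc b' v -> arc v a ->
    f \in non_nbrs S b :\: unlinked -> g \in non_nbrs S b :\: unlinked ->
    f != g -> ~~ arc g f -> nonadj a f -> nonadj a g ->
  exists2 x, x \in in_nbrs linked b' & arc v x.
Proof.
move=> bI b'I bb' cardR aN vN b'v va fR gR neq_fg gf af ag.
have [cardM _ _] := linked_counts bI b'I bb'.
have R_free := I_free_non_nbrs (subsetP (subset_in_nbrs S y) _ bI) S_free.
have [out_v _] := card_out_nbrs_Nnon bI cardR aN vN va.
have /card_gt0P[x] : 0 < #|out_nbrs (non_nbrs Nnon b) v| by rewrite out_v.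
rewrite mem_out_nbrs => /andP[xN vx]; exists x => //.
apply: contraT => /(unlinked_of_path bI b'I bb' xN b'v vx) xM.
suff : ~~ arc v x by rewrite vx.
apply: (triangle_no_in_arc R_free cardR (unlinked_non_nbrs bI)
  I_free2_unlinked cardM _ _ va fR gR neq_fg gf af ag xM).
  exact: (subsetP (non_nbrs_Nout_subset b)).
exact: (subsetP (non_nbrs_linked_subset b)).
Qed.

Lemma card_in_linked_Nin_neq2 b b' : b \in Nin -> b' \in Nin -> b != b' ->
  #|in_nbrs linked b| != 2.
Proof.
move=> bI b'I bb'; apply/eqP => in_b; have b'b : b' != b by rewrite eq_sym.
have [_ + _] := linked_counts bI b'I bb'.
rewrite in_b => -[/cards0_eq in_b'].
have /card_gt1P[u1 [u2 []]] : 1 < #|in_nbrs linked b| by rewrite in_b.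
rewrite !mem_in_nbrs => /andP[u1L u1b] /andP[u2L u2b] u12.
have [a1 a1O au1] := arc_from_Nout (proj1 (linkedP _ u1L)) bI u1b.
have [a2 a2O au2] := arc_from_Nout (proj1 (linkedP _ u2L)) bI u2b.
have a12 : a1 != a2.
  apply: contraNneq u12 => a12; apply/eqP.
  by apply: (out_linked_unique a1O u1L u2L au1); rewrite a12.
have [v1 [v1L _ va1 b'v1]] := returning_path bI b'I bb' a1O u1L au1 u1b.
have [v2 [v2L _ va2 b'v2]] := returning_path bI b'I bb' a2O u2L au2 u2b.
have v12 : v1 != v2.
  apply: contraNneq a12 => v12; apply/eqP.
  by apply: (Nout_nbr_unique v1L a1O a2O (arc_adj va1)); rewrite v12 arc_adj.
have nonA : [set a1; a2] \subset non_nbrs Nout b.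
  rewrite subUset !sub1set !mem_non_nbrs a1O a2O !(nonadjC b).
  by rewrite (nonadj_Nout_Nin a1O bI au1) // (nonadj_Nout_Nin a2O bI au2).
have nonL : [set v1; v2] \subset non_nbrs linked b.
  apply: subset_trans (nbrs_linked_subset b'I bI b'b).
  by rewrite subUset !sub1set !mem_nbrs v1L v2L !arc_adj.
have cardR : #|non_nbrs S b| = 8.
  apply: (card_non_nbrs_Nin_eq8 bI b'I bb').
  have := leq_add (subset_leq_card nonA) (subset_leq_card nonL).
  by rewrite !cards2 a12 v12.
move: nonA nonL; rewrite !subUset !sub1set => /andP[a1N a2N] /andP[v1N v2N].
have v2R := subsetP (non_nbrs_linked_subset b) _ v2N.
have a2R := subsetP (non_nbrs_Nout_subset b) _ a2N.
have a1v2 : nonadj a1 v2.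
  by apply: (nonadj_Nout_linked a1O a2O a12 v2L); rewrite arc_adj.
have a1a2 : nonadj a1 a2.
  exact: (independent_nonadj (@out_nbrs_independent S y)).
have [x] := arc_to_in_nbrs bI b'I bb' cardR a1N v1N b'v1 va1 v2R a2R
  (arc_neq va2) (negbT (arc_antisym va2)) a1v2 a1a2.
by rewrite in_b' inE.
Qed.

Lemma card_nbrs_linked_of_ge3 b b' a : b \in Nin -> b' \in Nin -> b != b' ->
    a \in non_nbrs Nout b' -> 3 <= #|nbrs linked b| ->
  #|non_nbrs S b'| = 8 /\ #|nbrs linked b'| = 2.
Proof.
move=> bI b'I bb' aN nbrs_ge3; have b'b : b' != b by rewrite eq_sym.
have [cardM _ _] := linked_counts bI b'I bb'; have := card_linked_unlinked.
have out_gt0 : 0 < #|non_nbrs Nout b'| by apply/card_gt0P; exists a.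
have := subset_leq_card (nbrs_linked_subset bI b'I bb').
have b'L : b' \in linked = false.
  apply/negP => /linkedP[/neq_Nnon_nbrs/(_ (mem_Nin_nbrs b'I))].
  by rewrite eqxx.
have := card_nbrs_non_nbrs linked b'; rewrite b'L cardM.
have := card_non_nbrs_Nin_eq8 b'I bI b'b.
by have := card_non_nbrs_Nin b'I bI b'b; lia.
Qed.

Lemma nbrs_linked_eq2 b u v : #|nbrs linked b| = 2 ->
  u \in in_nbrs linked b -> v \in out_nbrs linked b ->
  nbrs linked b = [set u; v].
Proof.
rewrite mem_in_nbrs mem_out_nbrs => card2 /andP[uL ub] /andP[vL bv].
apply/esym/eqP; rewrite eqEcard card2 cards2 subUset !sub1set !mem_nbrs uL vL.
rewrite [adj b u]adjC !arc_adj //=.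
by rewrite (contraTneq _ bv) // => <-; rewrite (arc_antisym ub).
Qed.

Lemma arc_to_return b b' a u v w : b \in Nin -> b' \in Nin -> b != b' ->
    a \in non_nbrs Nout b' -> 3 <= #|nbrs linked b| ->
    u \in in_nbrs linked b' -> v \in out_nbrs linked b' ->
    w \in nbrs linked b -> arc u w -> arc w a ->
  arc w v.
Proof.
move=> bI b'I bb' aN nbrs_ge3 uN vN wb uw wa.
have [cardR nbrs_eq2] := card_nbrs_linked_of_ge3 bI b'I bb' aN nbrs_ge3.
have wN := subsetP (nbrs_linked_subset bI b'I bb') _ wb.
have [_ out_w] := card_out_nbrs_Nnon b'I cardR aN wN wa.
have /card_gt0P[x] : 0 < #|out_nbrs (nbrs Nnon b') w| by rewrite out_w.
rewrite mem_out_nbrs mem_nbrs => /andP[/andP[xH b'x] wx].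
have : x \in nbrs linked b'.
  rewrite mem_nbrs b'x andbT; apply/linkedP; split=> //.
  by exists b'; rewrite // adjC.
rewrite (nbrs_linked_eq2 nbrs_eq2 uN vN) => /set2P[] xE; rewrite xE // in wx.
by rewrite (arc_antisym uw) in wx.
Qed.

(* If [b -> z], the sizes force [v2 -> v1], where [v1] and [v2] are the vertices
   returning from [u1] to [a1] and from [u2] to [a2]. *)
Lemma no_arc_to_third b b' a1 a2 a3 u1 u2 z :
    b \in Nin -> b' \in Nin -> b != b' ->
    a1 \in Nout -> a2 \in Nout -> a3 \in Nout -> a2 != a3 ->
    in_nbrs linked b = [set u1] -> u2 \in in_nbrs linked b' ->
    arc a1 u1 -> arc a2 u2 -> a1 != a2 -> z \in linked -> arc z a3 ->
  ~~ arc b z.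
Proof.
move=> bI b'I bb' a1O a2O a3O a23 in_b u2N au1 au2 a12 zL za3.
apply/negP => bz; have b'b : b' != b by rewrite eq_sym.
have /andP[u1L u1b] : (u1 \in linked) && arc u1 b.
  by rewrite -mem_in_nbrs in_b set11.
have /andP[u2L u2b'] : (u2 \in linked) && arc u2 b' by rewrite -mem_in_nbrs.
have [v1 [v1L uv1 _ b'v1]] := returning_path bI b'I bb' a1O u1L au1 u1b.
have [v2 [v2L uv2 va2 bv2]] := returning_path b'I bI b'b a2O u2L au2 u2b'.
have neq_u1 w : arc b w -> u1 != w.
  by apply: contraTneq => <-; rewrite (arc_antisym u1b).
have v2z : v2 != z.
  apply: contraNneq a23 => v2z; apply/eqP.
  by apply: (Nout_nbr_unique zL a2O a3O); rewrite -?v2z arc_adj // v2z.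
have a2N : a2 \in non_nbrs Nout b'.
  by rewrite mem_non_nbrs a2O nonadjC (nonadj_Nout_Nin a2O b'I au2).
have [u1b_nbr v2b_nbr zb_nbr] :
    [/\ u1 \in nbrs linked b, v2 \in nbrs linked b & z \in nbrs linked b].
  by rewrite !mem_nbrs u1L v2L zL [adj b u1]adjC !arc_adj.
have nbrs_ge3 : 3 <= #|nbrs linked b|.
  by apply/card_gt2P; exists u1, v2, z; rewrite neq_u1 // v2z eq_sym neq_u1.
have [cardR _] := card_nbrs_linked_of_ge3 bI b'I bb' a2N nbrs_ge3.
have v1N : v1 \in out_nbrs linked b' by rewrite mem_out_nbrs v1L.
have v21 := arc_to_return bI b'I bb' a2N nbrs_ge3 u2N v1N v2b_nbr uv2 va2.
have non_b' := subsetP (nbrs_linked_subset bI b'I bb').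
have a2u1 : nonadj a2 u1.
  apply: (nonadj_Nout_linked a2O a1O _ u1L); first by rewrite eq_sym.
  by rewrite adjC arc_adj.
have a2z : nonadj a2 z.
  by apply: (nonadj_Nout_linked a2O a3O a23 zL); rewrite arc_adj.
have sub := subsetP (non_nbrs_linked_subset b').
have zu1 : z != u1 by rewrite eq_sym neq_u1.
have [x] := arc_to_in_nbrs b'I bI b'b cardR a2N (non_b' _ v2b_nbr) bv2
  va2 (sub _ (non_b' _ zb_nbr)) (sub _ (non_b' _ u1b_nbr)) zu1
  (D_L3_free u1b bz) a2z a2u1.
rewrite in_b => /set1P-> v2u1; have := in_nonadj uv1 v21.
by rewrite adjC arc_adj.
Qed.

Lemma no_degree_five : False.
Proof.
have /card_gt1P[b [b' [bI b'I bb']]] : 1 < #|Nin| by rewrite card_in_y.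
have b'b : b' != b by rewrite eq_sym.
have [_ sum_in in_A] := linked_counts bI b'I bb'.
have := card_in_linked_Nin_neq2 bI b'I bb'.
have := card_in_linked_Nin_neq2 b'I bI b'b => neq2' neq2.
have /eqP/cards1P[u1 in_b] : #|in_nbrs linked b| = 1 by lia.
have /eqP/cards1P[u2 in_b'] : #|in_nbrs linked b'| = 1 by lia.
have u1N : u1 \in in_nbrs linked b by rewrite in_b set11.
have u2N : u2 \in in_nbrs linked b' by rewrite in_b' set11.
have [/andP[u1L u1b] /andP[u2L u2b']] :
    (u1 \in linked) && arc u1 b /\ (u2 \in linked) && arc u2 b'.
  by rewrite -!mem_in_nbrs.
have [[u1H _] [u2H _]] := (linkedP _ u1L, linkedP _ u2L).
have [a1 a1O au1] := arc_from_Nout u1H bI u1b.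
have [a2 a2O au2] := arc_from_Nout u2H b'I u2b'.
have a12 : a1 != a2.
  apply: contraNneq bb' => a12; apply/eqP.
  have u12 : u1 = u2 by apply: (out_linked_unique a1O u1L u2L au1); rewrite a12.
  by apply: (Nin_nbr_unique u1H bI b'I (arc_adj u1b)); rewrite u12 arc_adj.
have /card_gt0P[a3] : 0 < #|Nout :\: [set a1; a2]|.
  rewrite cardsD card_out_y subn_gt0.
  by rewrite (leq_ltn_trans (subset_leq_card (subsetIr _ _))) // cards2 a12.
case/setDP=> a3O; rewrite !inE negb_or => /andP[a31 a32].
have /card_gt0P[z] : 0 < #|in_nbrs linked a3| by rewrite in_A.
rewrite mem_in_nbrs => /andP[zL za3].
have [c + cz] := arc_from_Nin zL a3O za3.
rewrite (Nin_eq bI b'I bb') => /set2P[] cE; move: cz; rewrite cE; apply/negP.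
  by apply: (@no_arc_to_third b b' a1 a2 a3 u1 u2); rewrite // eq_sym.
by apply: (@no_arc_to_third b' b a2 a1 a3 u2 u1); rewrite // eq_sym.
Qed.

End DegreeFive.

Lemma I_free4_in_nbrs_neq2 S x : I_free 4 S -> #|S| = 14 -> x \in S ->
  #|out_nbrs S x| = 3 -> #|in_nbrs S x| != 2.
Proof.
move=> S_free cardS xS out_x; apply/eqP => in_x.
apply: (no_degree_five S_free xS out_x in_x).
by move: cardS; rewrite (card_nbrs_non_nbrs S x) xS card_nbrs out_x in_x => -[].
Qed.

End TriangleFree.

(** * Upper and lower bounds *)

Section Converse.

Variable D : oriented_graph.

Definition converse_arc : rel D := fun x y => arc y x.

Lemma converse_arc_asym x y :
  x != y -> ~~ (converse_arc x y && converse_arc y x).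
Proof. by rewrite andbC; apply: arc_asym. Qed.

Definition converse : oriented_graph :=
  OrientedGraph (@arc_irrefl D : irreflexive converse_arc) converse_arc_asym.

Lemma L3_free_converse : L3_free D -> L3_free converse.
Proof. by move=> D_L3_free x y z yx zy; apply: D_L3_free zy yx. Qed.

Lemma I_free_converse m (S : {set D}) :
  I_free m S -> I_free m (S : {set converse}).
Proof.
by move=> S_free I IS I_ind; apply: S_free IS _ => x y xI yI; apply: I_ind.
Qed.

End Converse.

Section IndependenceBounds.

Variable D : oriented_graph.
Hypothesis D_L3_free : L3_free D.
Implicit Types (x : D) (S : {set D}).

Lemma I_free4_card S : I_free 4 S -> #|S| <= 14.
Proof.
apply: (@I_free_card_improved _ D_L3_free 2) => // [R|R x R_free cardR xR].
  exact: I_free3_card.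
exact: I_free3_regular.
Qed.

Lemma I_free4_regular S x : I_free 4 S -> #|S| = 14 -> x \in S ->
  #|out_nbrs S x| = 3 /\ #|in_nbrs S x| = 3.
Proof.
move=> S_free cardS xS.
have := card_out_nbrs D_L3_free x S_free.
have := card_in_nbrs D_L3_free x S_free.
have := I_free3_card D_L3_free (I_free_non_nbrs xS S_free).
have := I_free4_in_nbrs_neq2 D_L3_free S_free cardS xS.
have : #|in_nbrs S x| = 3 -> #|out_nbrs S x| != 2.
  have cD_L3_free := L3_free_converse D_L3_free.
  exact: (I_free4_in_nbrs_neq2 cD_L3_free (I_free_converse S_free)).
by move: cardS; rewrite (card_nbrs_non_nbrs S x) xS card_nbrs; lia.
Qed.

Lemma I_free5_card S : I_free 5 S -> #|S| <= 22.
Proof.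
apply: (@I_free_card_improved _ D_L3_free 3) => // [R|R x R_free cardR xR].
  exact: I_free4_card.
exact: I_free4_regular.
Qed.

End IndependenceBounds.

Lemma I_free_setTP m (D : oriented_graph) :
  ~ (exists S : {set D}, #|S| = m /\ independent S) <-> I_free m [set: D].
Proof.
split=> [noI I _ I_ind|D_free [S [cardS S_ind]]]; last first.
  by have := D_free S (subsetT S) S_ind; rewrite cardS ltnn.
rewrite ltnNge; apply/negP => /card_geqP[s [s_uniq s_size sI]]; apply: noI.
exists [set x in s]; rewrite cardsE (card_uniqP s_uniq); split=> // x y.
by rewrite !inE => /sI xI /sI yI; apply: I_ind.
Qed.

Lemma transitive_triangle (D : oriented_graph) (x y z : D) :
  arc x y -> arc y z -> arc x z -> transitive_tournament [set x; y; z].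
Proof.
move=> xy yz xz.
have mem_xyz u : u \in [set x; y; z] -> [\/ u = x, u = y | u = z].
  rewrite !inE -orbA.
  by case/or3P=> /eqP->; [constructor 1 | constructor 2 | constructor 3].
split=> [u v|u v w] /mem_xyz + /mem_xyz.
  by case=> -> [] ->; rewrite ?eqxx ?xy ?yz ?xz ?orbT.
have [yx zy] := (arc_antisym xy, arc_antisym yz).
move=> + + /mem_xyz; do 3![case=> ->];
  by rewrite ?arc_irrefl ?xy ?yz ?xz ?yx ?zy ?(arc_antisym xz).
Qed.

Lemma L3_freeP (D : oriented_graph) :
  ~ (exists S : {set D}, #|S| = 3 /\ transitive_tournament S) <-> L3_free D.
Proof.
split=> [noL x y z xy yz|D_L3_free [L [cardL [L_tour L_trans]]]].
  apply/negP => xz; apply: noL; exists [set x; y; z]; split.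
    by rewrite -setUA !cardsU1 !inE cards1 negb_or !arc_neq.
  exact: transitive_triangle.
have no_path u v w : u \in L -> v \in L -> w \in L -> arc u v -> ~~ arc v w.
  move=> uL vL wL uv; apply/negP => vw.
  by have := D_L3_free _ _ _ uv vw; rewrite (L_trans v u w).
have /card_gt2P[x [y [z [[xL yL zL] [xy yz zx]]]]] : 2 < #|L| by rewrite cardL.
wlog xy_arc : x y xL yL xy yz zx / arc x y.
  move=> by_symmetry; have /orP[xy_arc|yx_arc] := L_tour x y xL yL xy.
    exact: by_symmetry xL yL xy yz zx xy_arc.
  by apply: by_symmetry yL xL _ _ _ yx_arc; rewrite eq_sym.
have zy_arc : arc z y.
  by have := L_tour y z yL zL yz; rewrite (negbTE (no_path x y z _ _ _ _)).
have /orP[zx_arc|xz_arc] := L_tour z x zL xL zx.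
  by have := no_path z x y zL xL yL zx_arc; rewrite xy_arc.
by have := no_path x z y xL zL yL xz_arc; rewrite zy_arc.
Qed.

Lemma IL_free3P m (D : oriented_graph) :
  IL_free m 3 D <-> I_free m [set: D] /\ L3_free D.
Proof. by rewrite /IL_free I_free_setTP L3_freeP. Qed.

Section Induced.

Variables (D : oriented_graph) (S : {set D}).

Definition induced_arc : rel {x | x \in S} := fun x y => arc (val x) (val y).

Lemma induced_arc_irrefl : irreflexive induced_arc.
Proof. by move=> x; apply: arc_irrefl. Qed.

Lemma induced_arc_asym x y : x != y -> ~~ (induced_arc x y && induced_arc y x).
Proof. exact: (@arc_asym D (val x) (val y)). Qed.

Definition induced := OrientedGraph induced_arc_irrefl induced_arc_asym.

Lemma card_induced : #|induced| = #|S|.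
Proof. by rewrite card_sig. Qed.

Lemma IL_free_induced m n : IL_free m n D -> IL_free m n induced.
Proof.
have cardV (I : {set induced}) : #|val @: I| = #|I| by apply/card_imset/val_inj.
case=> noI noL; split=> [[I [cardI I_ind]]|[L [cardL [L_tour L_trans]]]].
  apply: noI; exists (val @: I); rewrite cardV; split=> //.
  by move=> _ _ /imsetP[x xI ->] /imsetP[y yI ->]; apply: I_ind.
apply: noL; exists (val @: L); rewrite cardV; split=> //; split.
  move=> _ _ /imsetP[x xL ->] /imsetP[y yL ->] xy.
  by apply: L_tour => //; apply: contraNneq xy => ->.
move=> _ _ _ /imsetP[x xL ->] /imsetP[y yL ->] /imsetP[z zL ->].
exact: (L_trans x y z).
Qed.

End Induced.

Lemma is_r_of_witness m n (D : oriented_graph) :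
  IL_free m n D -> no_IL_free_on m n #|D|.+1 -> is_r m n #|D|.+1.
Proof.
move=> D_free no_next; split=> // j no_j; rewrite ltnNge; apply/negP.
case/card_geqP=> s [s_uniq s_size _].
apply: (no_j (induced [set x in s])); last exact: IL_free_induced.
by rewrite card_induced cardsE (card_uniqP s_uniq).
Qed.

Definition is_oriented_below (r : rel nat) n : bool :=
  all (fun i => all (fun j => ~~ (r i j && r j i)) (iota 0 n)) (iota 0 n).

Definition is_L3_free_below (r : rel nat) n : bool :=
  all (fun i => all (fun j => r i j ==>
    all (fun k => r j k ==> ~~ r i k) (iota 0 n)) (iota 0 n)) (iota 0 n).

Fixpoint no_independent (T : eqType) (r : rel T) m (s : seq T) : bool :=
  if m is m'.+1 then
    (fix no_independent_from s := if s is i :: s' then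
       no_independent r m' [seq j <- s' | ~~ r i j && ~~ r j i] &&
       no_independent_from s'
     else true) s
  else false.

Lemma no_independentP (T : eqType) (r : rel T) m s t :
  no_independent r m s -> subseq t s ->
  pairwise (fun i j => ~~ r i j && ~~ r j i) t -> size t != m.
Proof.
elim: m s t => [//|m IHm]; elim=> [[|//] //|i s IHs] [//|j t] /andP[no_i no_s].
rewrite [subseq _ _]/=; case: eqP => [->|_] sub /=; last exact: (IHs (j :: t)).
move=> /andP[it t_pair]; rewrite eqSS; apply: (IHm _ _ no_i) => //.
by rewrite subseq_filter it.
Qed.

Section OrdinalGraph.

Variables (r : rel nat) (n : nat).
Hypothesis r_oriented : is_oriented_below r n.

Definition ord_arc : rel 'I_n := fun i j => r i j.

Lemma ord_arc_irrefl : irreflexive ord_arc.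
Proof.
move=> i; apply/negbTE; rewrite -[ord_arc i i]andbb.
by apply: (allP (allP r_oriented i _)); rewrite mem_iota ltn_ord.
Qed.

Lemma ord_arc_asym i j : i != j -> ~~ (ord_arc i j && ord_arc j i).
Proof.
by move=> _; apply: (allP (allP r_oriented i _)); rewrite mem_iota ltn_ord.
Qed.

Definition ord_graph := OrientedGraph ord_arc_irrefl ord_arc_asym.

Lemma L3_free_ord_graph : is_L3_free_below r n -> L3_free ord_graph.
Proof.
have mem_V (i : 'I_n) : val i \in iota 0 n by rewrite mem_iota ltn_ord.
move=> r_L3 i j k ij jk.
have /implyP/(_ ij)/allP := allP (allP r_L3 i (mem_V i)) j (mem_V j).
by move=> /(_ k (mem_V k))/implyP/(_ jk).
Qed.

Lemma IL_free_ord_graph m :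
  is_L3_free_below r n -> no_independent r m (iota 0 n) ->
  IL_free m 3 ord_graph.
Proof.
move=> r_L3 r_indep; apply/IL_free3P; split; last exact: L3_free_ord_graph.
apply/I_free_setTP => -[I [cardI I_ind]].
have /eqP := cardI; apply/negP; rewrite cardE -(size_map val).
apply: no_independentP r_indep _ _.
  by rewrite -val_enum_ord; apply: map_subseq; rewrite enumT filter_subseq.
have {}I_ind i j : i \in enum I -> j \in enum I -> ~~ r i j.
  by rewrite !mem_enum; apply: I_ind.
rewrite pairwise_map; elim: (enum I) I_ind => //= i l IHl l_ind.
apply/andP; split.
  by apply/allP => j jl; rewrite /= !l_ind // inE ?eqxx ?jl ?orbT.
by apply: IHl => j k jl kl; apply: l_ind; rewrite inE ?jl ?kl orbT.
Qed.

End OrdinalGraph.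

(* Two circulant graphs on Z/7, with connection sets {1, 3} and {1, 5}, joined
   by the arcs from [i] to [i + 7] and from [i + 7] to [i - 1]. *)
Definition bicirculant14 (i j : nat) : bool :=
  (j + 14 - i) %% 7 \in
  match i < 7, j < 7 with
  | true, true => [:: 1; 3]
  | true, false => [:: 0]
  | false, true => [:: 6]
  | false, false => [:: 1; 5]
  end.

Definition circulant22 (i j : nat) : bool :=
  (j + 22 - i) %% 22 \in [:: 1; 4; 10; 17].

Lemma bicirculant14_oriented : is_oriented_below bicirculant14 14.
Proof. by vm_compute. Qed.

Lemma circulant22_oriented : is_oriented_below circulant22 22.
Proof. by vm_compute. Qed.

Lemma IL_free_bicirculant14 : IL_free 4 3 (ord_graph bicirculant14_oriented).
Proof. by apply: IL_free_ord_graph; vm_compute. Qed.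

Lemma IL_free_circulant22 : IL_free 5 3 (ord_graph circulant22_oriented).
Proof. by apply: IL_free_ord_graph; vm_compute. Qed.

Lemma is_r3_of_bound m (D : oriented_graph) : IL_free m 3 D ->
  (forall E : oriented_graph, L3_free E ->
    forall S : {set E}, I_free m S -> #|S| <= #|D|) ->
  is_r m 3 #|D|.+1.
Proof.
move=> D_free bound; apply: is_r_of_witness D_free _ => E cE.
by case/IL_free3P=> E_free /bound/(_ _ E_free); rewrite cardsT cE ltnn.
Qed.

Theorem mainTheorem1 : is_r 4 3 15 /\ is_r 5 3 23.
Proof.
split.
  have := is_r3_of_bound IL_free_bicirculant14; rewrite card_ord; apply.
  exact: I_free4_card.
have := is_r3_of_bound IL_free_circulant22; rewrite card_ord; apply.
exact: I_free5_card.
Qed.
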